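(* Let $r\geq 2$ be an integer and let $p=p(n)$ satisfy $p=\omega(n^{-1})$ and $p=o(n^{-1/r})$. Consider bootstrap percolation with infection threshold $r$ on the binomial random graph $G(n,p)$, where the initially infected set $\mathcal{A}(0)$ is chosen uniformly at random among all vertex subsets of size $a$, and let $\mathcal{A}_f$ be the final infected set. Let $a_c$ and $t_c$ be as defined in the context, and let $\alpha=\alpha(n)$ be any function with $\alpha=\omega(\sqrt{a_c})$ and $\alpha\leq a_c-r$. If $|\mathcal{A}(0)|=a_c-\alpha$, then with probability at least $$1-\exp\left(-(1+o(1))\frac{r\alpha^2}{2(t_0+r\alpha/3)}\right)$$ we have $|\mathcal{A}_f|<t_c$.
   Context: $G(n,p)$ has vertex set $[n]=\{1,\dots,n\}$, each edge present independently with probability $p$. Bootstrap percolation with threshold $r$: starting from $\mathcal{A}(0)$, in each round every uninfected vertex with at least $r$ infected neighbours becomes infected; infected vertices stay infected; $\mathcal{A}_f$ is the set of infected vertices when the process stabilises. All asymptotics are as $n\to\infty$ and $n$ is assumed sufficiently large. Define $\delta:=\max\{(np^r)^{1/(2(r-1))},(np)^{-1/(4(r-1))}\}$ (so $\delta=o(1)$), $t_0:=\left((1+\delta)\frac{(r-1)!}{np^r}\right)^{1/(r-1)}$, $\hat{\pi}(t):=\mathbb{P}[\mathrm{Bin}(t,p)\geq r]$, $a_c:=-\min_{t\leq t_0}\frac{n\hat{\pi}(t)-t}{1-\hat{\pi}(t)}$, and $t_c$ the smallest $t$ at which this minimum is attained. *)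

(* Defs.v *)
From HB Require Import structures.
From mathcomp Require Import all_boot all_order all_algebra.
From mathcomp Require Import all_classical all_reals all_analysis.

Set Implicit Arguments.
Unset Strict Implicit.
Unset Printing Implicit Defensive.

Import Order.TTheory GRing.Theory Num.Theory.
Import numFieldNormedType.Exports.

Local Open Scope classical_set_scope.
Local Open Scope ring_scope.

Section Bootstrap.
Variable n : nat.

(* Graphs on 'I_n are given by their edge set, a set of two-element vertex
   sets. *)
Definition vpairs : {set {set 'I_n}} := [set e : {set 'I_n} | #|e| == 2%N]%SET.

Definition adj (E : {set {set 'I_n}}) (u v : 'I_n) : bool :=
  [set u; v]%SET \in E.

Definition bp_round (r : nat) (E : {set {set 'I_n}}) (A : {set 'I_n}) :
    {set 'I_n} :=
  (A :|: [set v | (r <= #|[set u in A | adj E u v]|)%N])%SET.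

(* The infected set can grow at most n times before the process stabilises;
   see [bp_final_stable]. *)
Definition bp_final (r : nat) (E : {set {set 'I_n}}) (A0 : {set 'I_n}) :
    {set 'I_n} :=
  iter n (bp_round r E) A0.

Lemma bp_final_stable r E A0 k : (n <= k)%N ->
  iter k (bp_round r E) A0 = bp_final r E A0.
Proof.
set f := bp_round r E; set s := fun i => iter i f A0.
have fix_after i j : s i.+1 = s i -> s (j + i)%N = s i.
  move=> si; elim: j => [//|j IHj]; by rewrite addSn {1}/s iterS -/(s _) IHj.
have grow m : (m <= #|s m|)%N \/ exists2 i, (i < m)%N & s i.+1 = s i.
  elim: m => [|m [le_m|[i lt_im si]]]; first by left.
    have [smE|sm_neq] := eqVneq (s m.+1) (s m); first by right; exists m.
    left; apply: leq_ltn_trans le_m _; apply: proper_card.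
    by rewrite finset.properEneq eq_sym sm_neq; exact: finset.subsetUl.
  by right; exists i => //; exact: ltnW.
have sn : s n.+1 = s n.
  case: (grow n) => [le_n|[i lt_in si]].
    have sT : s n = [set: 'I_n]%SET.
      by apply/eqP; rewrite finset.eqEcard finset.subsetT cardsT card_ord.
    by apply/eqP; rewrite eq_sym finset.eqEsubset finset.subsetUl {1}sT finset.subsetT.
  have := fix_after i (n.+1 - i)%N si; have := fix_after i (n - i)%N si.
  by rewrite !subnK ?(ltnW lt_in)// => [-> ->//|]; exact/ltnW/ltnW.
by move=> /subnK => <-; exact: fix_after.
Qed.

End Bootstrap.

(* Probability, over G ~ G(n,p) and an independent A(0) uniform among the
   a-element vertex subsets, that the event [Q] of (edge set of G, A(0))
   holds. *)
Definition gnp_weight (R : realType) (n : nat) (p : R)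
    (E : {set {set 'I_n}}) : R :=
  \prod_(e in vpairs n) (if e \in E then p else 1 - p).

Definition bp_prob (R : realType) (n : nat) (p : R) (a : nat)
    (Q : {set {set 'I_n}} -> {set 'I_n} -> bool) : R :=
  \sum_(E in powerset (vpairs n)) \sum_(A : {set 'I_n} | #|A| == a)
    gnp_weight p E / 'C(n, a)%:R * (Q E A)%:R.

Section Critical.
Variables (R : realType) (r n : nat) (p : R).

Definition bp_delta : R :=
  Num.max ((n%:R * p ^+ r) `^ (2 * r.-1%:R)^-1)
          ((n%:R * p) `^ (- (4 * r.-1%:R)^-1)).

Definition bp_t0 : R :=
  ((1 + bp_delta) * (r.-1`!%:R / (n%:R * p ^+ r))) `^ (r.-1%:R)^-1.

Definition pi_hat (t : nat) : R :=
  fine (binomial_prob t p [set k | (r <= k)%N]).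

Definition bp_drift (t : nat) : R :=
  (n%:R * pi_hat t - t%:R) / (1 - pi_hat t).

(* The integers t with 0 <= t <= t_0. *)
Definition bp_times : seq nat := iota 0 (Num.truncn bp_t0).+1.

Definition bp_ac : R :=
  - \big[Num.min/bp_drift 0]_(t <- bp_times) bp_drift t.

(* Since [bp_times] enumerates 0, 1, 2, ..., the position of the first minimiser
   is the first minimiser itself. *)
Definition bp_tc : nat := find [pred t | bp_drift t == - bp_ac] bp_times.

End Critical.

(* f = omega(g), for nonnegative g that is eventually nonzero. *)
Definition little_omega (R : realType) (f g : nat -> R) : Prop :=
  f n / g n @[n --> \oo] --> +oo.

(* Main.v *)
Require Import Defs.
From HB Require Import structures.
From mathcomp Require Import all_boot all_order all_algebra.
From mathcomp Require Import all_classical all_reals all_analysis.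
From mathcomp Require Import ring lra.

(* Explore the infected vertices one at a time.  Revealing the neighbourhood of
   an explored vertex only affects unexplored vertices, so an induction on the
   number of steps bounds P(|A_f| >= t) z^t by z^a E[z^Bin(n - a, pi_hat t)] for
   every z >= 1.  At t = t_c the binomial exceeds its mean by
   alpha (1 - pi_hat t_c) on this event, and Bernstein's inequality applies, as
   n pi_hat t_c <= (1 + delta) t_0 / r.  Both delta and pi_hat t_c are o(1). *)

Import Order.TTheory GRing.Theory Num.Theory.
Import numFieldNormedType.Exports.

Local Open Scope ring_scope.

Section RandomSubset.
Local Set Implicit Arguments.
Local Unset Strict Implicit.
Variables (R : realType) (p : R).

Definition rsub_exp (T : finType) (D : {set T}) (f : {set T} -> R) : R :=
  \sum_(E in powerset D) (\prod_(e in D) (if e \in E then p else 1 - p)) * f E.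

Lemma eq_rsub_exp (T : finType) (D : {set T}) (f g : {set T} -> R) :
  (forall E : {set T}, E \subset D -> f E = g E) -> rsub_exp D f = rsub_exp D g.
Proof.
move=> fg; apply: eq_bigr => E; rewrite finset.powersetE => ED.
by rewrite fg.
Qed.

Lemma ler_rsub_exp (T : finType) (D : {set T}) (f g : {set T} -> R) :
  0 <= p <= 1 -> (forall E : {set T}, E \subset D -> f E <= g E) ->
  rsub_exp D f <= rsub_exp D g.
Proof.
move=> /andP[p0 p1] fg; apply: ler_sum => E; rewrite finset.powersetE => ED.
apply: ler_wpM2l (fg _ ED); apply: prodr_ge0 => e _.
by case: ifP; rewrite ?subr_ge0.
Qed.

Lemma rsub_expZ (T : finType) (D : {set T}) (f : {set T} -> R) (c : R) :
  rsub_exp D (fun E => f E * c) = rsub_exp D f * c.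
Proof. by rewrite /rsub_exp mulr_suml; apply: eq_bigr => E _; rewrite mulrA. Qed.

Lemma rsub_expB (T : finType) (D : {set T}) (f g : {set T} -> R) :
  rsub_exp D (fun E => f E - g E) = rsub_exp D f - rsub_exp D g.
Proof. by rewrite /rsub_exp -sumrB; apply: eq_bigr => E _; rewrite mulrBr. Qed.

Lemma rsub_exp0 (T : finType) (f : {set T} -> R) :
  rsub_exp finset.set0 f = f finset.set0.
Proof.
by rewrite /rsub_exp finset.powerset0 finset.big_set1 finset.big_set0 mul1r.
Qed.

Lemma rsub_expD1 (T : finType) (D : {set T}) (e : T) (f : {set T} -> R) :
  e \in D ->
  rsub_exp D f = p * rsub_exp (D :\ e) (fun E => f (e |: E)) +
                 (1 - p) * rsub_exp (D :\ e) f.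
Proof.
move=> eD; rewrite /rsub_exp (bigID (fun E : {set T} => e \in E)) /=.
congr (_ + _); rewrite mulr_sumr.
  rewrite (reindex_onto (fun E => e |: E) (fun E => E :\ e)) /=; last first.
    by move=> E /andP[_ eE]; rewrite finset.setD1K.
  rewrite (eq_bigl (fun E : {set T} => E \in powerset (D :\ e))); last first.
    move=> E; rewrite !finset.powersetE finset.setU11 andbT.
    rewrite finset.subUset finset.sub1set eD /= finset.subsetD1.
    congr (_ && _); apply/eqP/idP => [<-|eE]; first by rewrite finset.setD11.
    by rewrite finset.setU1K.
  apply: eq_bigr => E _; rewrite (finset.big_setD1 e eD) finset.setU11 /= -!mulrA.
  congr (_ * (_ * _)); apply: eq_bigr => x /finset.setD1P[xe _].
  by rewrite finset.in_setU1 (negbTE xe).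
apply: eq_big => [E|E /andP[_ /negbTE eE]].
  by rewrite !finset.powersetE finset.subsetD1.
by rewrite (finset.big_setD1 e eD) eE -mulrA.
Qed.

Lemma rsub_expU (T : finType) (D1 D2 : {set T}) (f : {set T} -> R) :
  [disjoint D1 & D2] ->
  rsub_exp (D1 :|: D2) f =
  rsub_exp D1 (fun E1 => rsub_exp D2 (fun E2 => f (E1 :|: E2))).
Proof.
elim: {D1}#|D1| {-2}D1 (erefl #|D1|) f => [|k IHk] D1 cD1 f dis.
  rewrite (finset.cards0_eq cD1) finset.set0U rsub_exp0.
  by apply: eq_rsub_exp => E _; rewrite finset.set0U.
have [e eD1] : exists e, e \in D1.
  by apply/finset.set0Pn; rewrite -finset.card_gt0 cD1.
have eD2 : e \notin D2.
  by apply/negP => eD2; move/pred0P: dis => /(_ e) /=; rewrite eD1 eD2.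
have cD : #|D1 :\ e| = k by move: cD1; rewrite (finset.cardsD1 e) eD1 => -[].
have disD : [disjoint D1 :\ e & D2].
  by apply: disjointWl dis; exact: finset.subD1set.
have eU : (D1 :|: D2) :\ e = (D1 :\ e) :|: D2.
  apply/finset.setP => x; rewrite !finset.inE.
  by case: eqP => [->|]; rewrite ?(negbTE eD2).
rewrite (@rsub_expD1 _ (D1 :|: D2) e) ?finset.inE ?eD1// eU !IHk//.
rewrite (rsub_expD1 _ eD1).
congr (_ * _ + _); apply: eq_rsub_exp => E _; apply: eq_rsub_exp => F _.
by rewrite finset.setUA.
Qed.

Lemma rsub_exp_prod (I T : finType) (A : {set I}) (h : I -> T)
    (g : I -> bool -> R) :
  {in A &, injective h} ->
  rsub_exp (h @: A) (fun E => \prod_(i in A) g i (h i \in E)) =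
  \prod_(i in A) (p * g i true + (1 - p) * g i false).
Proof.
elim: {A}#|A| {-2}A (erefl #|A|) => [|k IHk] A cA hI.
  by rewrite (finset.cards0_eq cA) finset.imset0 rsub_exp0 !finset.big_set0.
have [i iA] : exists i, i \in A.
  by apply/finset.set0Pn; rewrite -finset.card_gt0 cA.
have cD : #|A :\ i| = k by move: cA; rewrite (finset.cardsD1 i) iA => -[].
have hD : (h @: A) :\ h i = h @: (A :\ i).
  apply/finset.setP => x; rewrite !finset.inE; apply/andP/finset.imsetP.
    move=> [xi /finset.imsetP[j jA xE]]; exists j => //; rewrite !finset.inE jA andbT.
    by apply: contraNneq xi => ji; rewrite xE ji.
  move=> [j /finset.setD1P[ji jA] ->]; split; last exact: finset.imset_f.
  by apply: contraNneq ji => /hI ->.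
rewrite (@rsub_expD1 _ _ (h i)) ?finset.imset_f// hD (finset.big_setD1 i iA) /=.
have hI' : {in A :\ i &, injective h}.
  by move=> x y /finset.setD1P[_ xA] /finset.setD1P[_ yA]; exact: hI.
rewrite -(IHk _ cD hI') [RHS]mulrDl -!mulrA; congr (p * _ + (1 - p) * _).
  rewrite mulrC -rsub_expZ; apply: eq_rsub_exp => E _.
  rewrite (finset.big_setD1 i iA) finset.setU11 mulrC; congr (_ * _).
  apply: eq_bigr => j /finset.setD1P[ji jA]; rewrite finset.in_setU1.
  by case: eqP => [/hI|//]; move/(_ jA iA)/eqP; rewrite (negbTE ji).
rewrite mulrC -rsub_expZ; apply: eq_rsub_exp => E EA.
rewrite (finset.big_setD1 i iA) mulrC; congr (_ * _); congr (g i _).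
apply/negbTE/negP => /(fintype.subsetP EA) /finset.imsetP[j /finset.setD1P[ji jA]].
by move/hI => /(_ iA jA) ij; rewrite ij eqxx in ji.
Qed.

Lemma rsub_exp1 (T : finType) (D : {set T}) : rsub_exp D (fun=> 1) = 1.
Proof.
transitivity (rsub_exp (id @: D) (fun=> \prod_(i in D) (1 : R))).
  by rewrite finset.imset_id; apply: eq_rsub_exp => E _; rewrite big1.
rewrite (@rsub_exp_prod _ _ _ id (fun _ _ => 1)); last by move=> ? ? _ _.
by rewrite big1// => i _; ring.
Qed.

End RandomSubset.

Section Exploration.
Local Set Implicit Arguments.
Local Unset Strict Implicit.
Variables (R : realType) (p : R) (r : nat) (V : finType).
Hypothesis p01 : 0 <= p <= 1.

(* The probability that [m + Bin(k, p)] is at least [r]. *)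
Fixpoint hit_prob (k m : nat) : R :=
  if k is k'.+1 then p * hit_prob k' m.+1 + (1 - p) * hit_prob k' m
  else (r <= m)%N%:R.

Lemma hit_prob_ge0 k m : 0 <= hit_prob k m.
Proof.
have /andP[p0 p1] := p01.
elim: k m => [|k IHk] m /=; first exact: ler0n.
by rewrite addr_ge0 ?mulr_ge0 ?subr_ge0.
Qed.

Lemma hit_prob1 k m : (r <= m)%N -> hit_prob k m = 1.
Proof.
elim: k m => [|k IHk] m rm /=; first by rewrite rm.
by rewrite !IHk// ?(leq_trans rm)//; ring.
Qed.

Lemma hit_prob_le k m : hit_prob k m <= p ^+ (r - m) *+ 'C(k, r - m).
Proof.
have /andP[p0 p1] := p01.
elim: k m => [|k IHk] m.
  have [rm|mr] := leqP r m.
    by rewrite hit_prob1//; move: rm; rewrite -subn_eq0 => /eqP ->.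
  by rewrite /= leqNgt mr /= mulrn_wge0// exprn_ge0.
have [rm|mr] := leqP r m.
  by rewrite hit_prob1//; move: rm; rewrite -subn_eq0 => /eqP ->; rewrite bin0.
have e : (r - m = (r - m.+1).+1)%N by rewrite subnS prednK// subn_gt0.
rewrite /= e binS mulrnDr addrC lerD//.
  rewrite -e (le_trans _ (IHk m))//.
  by rewrite ler_piMl ?hit_prob_ge0// lerBlDl lerDr.
by rewrite exprS -mulrnAr ler_wpM2l.
Qed.

Definition upairs (W : {set V}) : {set {set V}} :=
  finset (fun e : {set V} => (#|e| == 2%N) && (e \subset W)).

(* [m w] counts the infected neighbours of [w] outside [W], so that the process
   on [W] infects exactly the least such [B]. *)
Definition bclosed (E : {set {set V}}) (W : {set V}) (m : V -> nat)
    (B : {set V}) : bool :=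
  [forall w in W,
    (r <= m w + #|finset (fun v => (v \in B) && ([set v; w]%SET \in E))|)%N
    ==> (w \in B)].

Definition all_bclosed_large (k : nat) (W : {set V}) (m : V -> nat)
    (E : {set {set V}}) : bool :=
  [forall B : {set V}, (B \subset W) && bclosed E W m B ==> (k <= #|B|)%N].

Lemma upairsD1 (W : {set V}) u : u \in W ->
  upairs W = ((fun w => [set u; w]%SET) @: (W :\ u)) :|: upairs (W :\ u).
Proof.
move=> uW; apply/finset.setP => e; rewrite !finset.inE.
apply/andP/orP => [[/finset.cards2P[x [y [xy ->]]]]|].
  rewrite finset.subUset !finset.sub1set => /andP[xW yW].
  have [xE|xu] := eqVneq x u.
    left; apply/finset.imsetP; exists y; last by rewrite xE.
    by rewrite !finset.inE yW andbT -xE eq_sym.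
  have [->|yu] := eqVneq y u.
    left; apply/finset.imsetP; exists x; first by rewrite !finset.inE xW xu.
    by rewrite finset.setUC.
  right; rewrite finset.cards2 xy /=.
  by rewrite finset.subUset !finset.sub1set !finset.inE xu yu xW yW.
case=> [/finset.imsetP[w /finset.setD1P[wu wW] ->]|/andP[e2 eW]].
  by rewrite finset.cards2 (eq_sym u) wu finset.subUset !finset.sub1set uW wW.
by split => //; apply: fintype.subset_trans eW _; exact: finset.subD1set.
Qed.

Lemma disjoint_star_upairs (W : {set V}) u :
  [disjoint ((fun w => [set u; w]%SET) @: (W :\ u)) & upairs (W :\ u)].
Proof.
apply/pred0P => e /=; apply/negbTE/negP.
case/andP => /finset.imsetP[w _ ->]; rewrite finset.inE => /andP[_].
by rewrite finset.subUset finset.sub1set !finset.inE eqxx.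
Qed.

Lemma all_bclosed_large_explore k (W : {set V}) u (m : V -> nat)
    (E1 E2 : {set {set V}}) :
  u \in W -> E1 \subset (fun w => [set u; w]%SET) @: (W :\ u) ->
  E2 \subset upairs (W :\ u) ->
  all_bclosed_large k.+1 W m (E1 :|: E2) ->
  all_bclosed_large k (W :\ u) (fun w => m w + ([set u; w]%SET \in E1))%N E2.
Proof.
move=> uW E1s E2s /forallP large; apply/forallP => B; apply/implyP => /andP[BW].
move=> /forallP Bc.
have uB : u \notin B.
  by apply/negP => /(fintype.subsetP BW); rewrite finset.setD11.
have := large (u |: B); rewrite finset.cardsU1 uB add1n ltnS => /implyP; apply.
rewrite finset.subUset finset.sub1set uW /=.
rewrite (fintype.subset_trans BW) ?finset.subD1set//=.
apply/forallP => w; apply/implyP => wW; apply/implyP => rw.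
have [->|wu] := eqVneq w u; first by rewrite finset.setU11.
apply/finset.setU1P; right.
have wWu : w \in W :\ u by rewrite !finset.inE wu.
have := Bc w; rewrite wWu /= => /implyP; apply; apply: leq_trans rw _.
rewrite -addnA leq_add2l.
set S := finset _; rewrite (finset.cardsD1 u S); apply: leq_add.
  rewrite /S !finset.inE eqxx /=; case E1u : (_ \in E1) => //=.
  case E2u: (_ \in E2) => //; have := fintype.subsetP E2s _ E2u.
  by rewrite finset.inE finset.subUset finset.sub1set !finset.inE eqxx andbF.
apply/subset_leq_card/fintype.subsetP => v; rewrite !finset.inE => /and3P[vu].
rewrite (negbTE vu) /= => vB /orP[vw|->]; last by rewrite vB.
have /finset.imsetP[x _] := fintype.subsetP E1s _ vw.
move/finset.setP => /(_ u); rewrite !finset.inE eqxx /= => /orP[]/eqP uE.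
  by rewrite uE eqxx in vu.
by rewrite uE eqxx in wu.
Qed.

(* Exploring an infected [u] reveals its neighbourhood in [W]; averaging over it
   turns the product for [k] steps into the one for [k.+1] steps. *)
Lemma all_bclosed_large_mgf k (W : {set V}) (m : V -> nat) (z : R) : 1 <= z ->
  rsub_exp p (upairs W) (fun E => (all_bclosed_large k W m E)%:R) * z ^+ k <=
  \prod_(w in W) (1 + (z - 1) * hit_prob k (m w)).
Proof.
move=> z1; have z0 : 0 <= z by apply: le_trans z1.
elim: k W m => [|k IHk] W m.
  rewrite expr0 mulr1; apply: (@le_trans _ _ 1).
    rewrite -[leRHS](@rsub_exp1 _ p _ (upairs W)).
    by apply: ler_rsub_exp => // E _; rewrite lern1 leq_b1.
  rewrite -[leLHS](@big1_eq _ _ *%R _ (enum W) xpredT) big_enum_cond /=.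
  rewrite (eq_bigl (mem W)) => [|w]; last by rewrite andbT.
  apply: ler_prod => w _; rewrite ler01 lerDl mulr_ge0 ?subr_ge0//.
have [u /andP[uW ru]|no_u] := pickP [pred u | (u \in W) && (r <= m u)%N]; last first.
  apply: (@le_trans _ _ 0); last first.
    by apply: prodr_ge0 => w _; rewrite addr_ge0 ?mulr_ge0 ?subr_ge0 ?hit_prob_ge0.
  rewrite mulr_le0_ge0 ?exprn_ge0// /rsub_exp big1// => E _.
  have -> : all_bclosed_large k.+1 W m E = false; last by rewrite mulr0.
  apply/negbTE/forallPn; exists finset.set0.
  rewrite finset.cards0 finset.sub0set /= implybF negbK.
  apply/forallP => w; apply/implyP => wW; apply/implyP.
  rewrite (_ : finset _ = finset.set0) ?finset.cards0 ?addn0; last first.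
    by apply/finset.setP => v; rewrite !finset.inE.
  by move=> rw; move: (no_u w); rewrite /= wW rw.
rewrite (upairsD1 uW) rsub_expU ?disjoint_star_upairs//.
set star := imset _ _.
pose m' (E1 : {set {set V}}) w := (m w + ([set u; w]%SET \in E1))%N.
apply: (@le_trans _ _ (rsub_exp p star (fun E1 =>
    \prod_(w in W :\ u) (1 + (z - 1) * hit_prob k (m' E1 w))) * z)).
  rewrite exprSr mulrA -rsub_expZ ler_wpM2r//; apply: ler_rsub_exp => // E1 E1s.
  apply: le_trans (IHk (W :\ u) (m' E1)).
  rewrite ler_wpM2r ?exprn_ge0//; apply: ler_rsub_exp => // E2 E2s.
  rewrite ler_nat; case large: all_bclosed_large => //=.
  by rewrite (all_bclosed_large_explore uW E1s E2s large).
rewrite /star (@rsub_exp_prod _ p _ _ _ (fun w => [set u; w]%SET)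
  (fun w b => 1 + (z - 1) * hit_prob k (m w + b))); last first.
  move=> x y /finset.setD1P[xu _] _ /finset.setP /(_ x).
  by rewrite !finset.inE eqxx (negbTE xu) => /esym/eqP.
rewrite [leRHS](finset.big_setD1 u uW) (hit_prob1 k.+1 ru) mulr1 addrCA subrr addr0.
rewrite mulrC ler_wpM2l//.
rewrite (eq_bigr (fun w => 1 + (z - 1) * hit_prob k.+1 (m w)))// => w _.
by rewrite addn1 addn0 /=; ring.
Qed.

End Exploration.

Lemma bp_final_all_bclosed_large (n r t : nat) (E : {set {set 'I_n}})
    (A0 : {set 'I_n}) :
  (t <= #|bp_final r E A0|)%N ->
  all_bclosed_large r t finset.setT (fun w => if w \in A0 then r else 0%N) E.
Proof.
move=> tA; apply/forallP => B; apply/implyP => /andP[_ /forallP Bc].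
apply: leq_trans tA _; apply: subset_leq_card.
suff iterB k : iter k (bp_round r E) A0 \subset B by exact: iterB.
elim: k => [|k IHk] /=.
  apply/fintype.subsetP => w wA; have := Bc w.
  by rewrite finset.in_setT wA leq_addr.
rewrite /bp_round finset.subUset IHk; apply/fintype.subsetP => w.
rewrite finset.inE => rw; have := Bc w; rewrite finset.in_setT /= => /implyP; apply.
apply: leq_trans rw _; apply: leq_trans (leq_addl _ _).
apply/subset_leq_card/fintype.subsetP => v; rewrite !finset.inE => /andP[vA vw].
by rewrite (fintype.subsetP IHk).
Qed.

Lemma bp_prob_ge (R : realType) (n a : nat) (p y : R)
    (Q : {set {set 'I_n}} -> {set 'I_n} -> bool) :
  (a <= n)%N ->
  (forall A : {set 'I_n}, #|A| = a ->
     rsub_exp p (vpairs n) (fun E => (~~ Q E A)%:R) <= y) ->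
  1 - y <= bp_prob p a Q.
Proof.
move=> an Qy; rewrite /bp_prob exchange_big /=.
have C0 : (0 : R) < 'C(n, a)%:R by rewrite ltr0n bin_gt0.
have -> : 1 - y = \sum_(A : {set 'I_n} | #|A| == a) (1 - y) / 'C(n, a)%:R.
  rewrite sumr_const.
  rewrite (eq_card (B := [set A : {set 'I_n} | #|A| == a]%SET)); last first.
    by move=> A; rewrite finset.inE.
  by rewrite card_draws card_ord -[RHS]mulr_natr divfK// gt_eqF.
apply: ler_sum => A /eqP cA.
rewrite -[leRHS](_ : rsub_exp p (vpairs n) (fun E => (Q E A)%:R) / 'C(n, a)%:R = _).
  apply: ler_wpM2r; first by rewrite invr_ge0 ltW.
  rewrite lerBlDr -lerBlDl.
  apply: le_trans (Qy A cA).
  rewrite -[X in X - _](rsub_exp1 p (vpairs n)) -rsub_expB.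
  rewrite le_eqVlt; apply/orP; left; apply/eqP; apply: eq_rsub_exp => E _.
  by case: (Q E A); rewrite /= ?subrr ?subr0.
rewrite -rsub_expZ /rsub_exp; apply: eq_bigr => E _; rewrite /gnp_weight.
by rewrite mulrAC mulrA.
Qed.

Lemma bp_prob_mgf (R : realType) (r n a t : nat) (p z : R) :
  0 <= p <= 1 -> (a <= n)%N -> 1 <= z ->
  1 - z ^+ a * (1 + (z - 1) * hit_prob p r t 0) ^+ (n - a) / z ^+ t <=
  bp_prob p a (fun E A0 : {set _} => #|@bp_final n r E A0| < t)%N.
Proof.
move=> p01 an z1; have z0 : 0 < z by exact: lt_le_trans z1.
apply: bp_prob_ge => // A cA.
rewrite ler_pdivlMr ?exprn_gt0//.
pose m (w : 'I_n) := if w \in A then r else 0%N.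
have -> : vpairs n = upairs finset.setT.
  by apply/finset.setP => e; rewrite !finset.inE finset.subsetT andbT.
apply: le_trans (_ : rsub_exp p (upairs finset.setT)
    (fun E => (all_bclosed_large r t finset.setT m E)%:R) * z ^+ t <= _).
  apply: ler_wpM2r; first by rewrite exprn_ge0// ltW.
  apply: ler_rsub_exp => // E _.
  rewrite -leqNgt ler_nat; case tE: (t <= _)%N => //.
  by rewrite /m (bp_final_all_bclosed_large _ _ _ _ _ tE).
apply: (le_trans (all_bclosed_large_mgf r p01 t finset.setT m z1)).
rewrite (bigID (mem A)) /=.
rewrite (eq_bigr (fun=> z)) => [|w /andP[_ wA]]; last first.
  by rewrite /m wA hit_prob1//; ring.
rewrite (eq_bigl (mem A)) => [|w]; last by rewrite finset.in_setT.
rewrite prodr_const cA.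
rewrite (eq_bigr (fun=> 1 + (z - 1) * hit_prob p r t 0)) => [|w /andP[_ wA]]; last first.
  by rewrite /m (negbTE wA).
rewrite (eq_bigl (fun w => w \in ~: A)) => [|w]; last first.
  by rewrite finset.in_setT finset.in_setC.
by rewrite prodr_const [#|~: A|%SET]finset.cardsCs finset.setCK card_ord cA.
Qed.

Lemma hit_probE (R : realType) (p : R) (r k m : nat) :
  hit_prob p r k m = \sum_(j < k.+1) binomial_pmf k p j * (r <= m + j)%N%:R.
Proof.
elim: k m => [|k IHk] m.
  by rewrite big_ord_recl big_ord0 /binomial_pmf /= addn0 addr0 !mul1r.
rewrite /= !IHk.
rewrite [RHS]big_ord_recl [in RHS](eq_bigr (fun j : 'I_k.+1 =>
   p * (binomial_pmf k p j * (r <= m.+1 + j)%N%:R) +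
   (1 - p) * (p ^+ j.+1 * (1 - p) ^+ (k - j.+1) *+ 'C(k, j.+1) * (r <= m + j.+1)%N%:R))).
  rewrite big_split /= -!mulr_sumr addrCA; congr (_ + _).
  rewrite [in LHS]big_ord_recl [in RHS]big_ord_recr /= bin_small// mulr0n mul0r addr0.
  rewrite mulrDr; congr (_ + _).
  by rewrite /binomial_pmf /= !bin0 !subn0 !expr0 !mul1r !mulr1n exprS mulrA.
move=> j _; rewrite /binomial_pmf /= /bump /= add1n addnS addSn binS mulrnDr mulrDl addrC.
congr (_ + _).
  by rewrite subSS exprS; ring.
have [jk|kj] := leqP j.+1 k; last by rewrite !bin_small// !mulr0n !mul0r mulr0.
rewrite subSS [in LHS](_ : k - j = (k - j.+1).+1)%N; last first.
  by rewrite subnS prednK// subn_gt0.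
by rewrite [(1 - p) ^+ _.+1]exprS; ring.
Qed.

Lemma pi_hatE (R : realType) (p : R) (r t : nat) :
  0 <= p <= 1 -> pi_hat r p t = hit_prob p r t 0.
Proof.
move=> /andP[p0 p1]; rewrite /pi_hat (@binomial_probE _ _ _ p0 p1) hit_probE.
under eq_bigr do rewrite diracE -EFinM.
rewrite sumEFin /=; apply: eq_bigr => j _; congr (_ * _%:R).
by congr nat_of_bool; rewrite add0n; apply/asboolP/idP.
Qed.

Lemma derive_ge0_le (R : realType) (f df : R -> R) (x : R) : 0 <= x ->
  (forall y : R, is_derive y 1 f (df y)) -> (forall y, 0 <= y -> 0 <= df y) ->
  f 0 <= f x.
Proof.
move=> x0 fd df0.
have fdrv y : derivable f y 1 by have [] := fd y.
have cf : ({within `[0, x], continuous f})%classic.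
  apply: continuous_subspaceT => y.
  exact/differentiable_continuous/derivable1_diffP.
apply: (ger0_derive1_le_cc _ _ cf) => //.
- move=> y; rewrite in_itv /= => /andP[y0 _].
  by have [_] := fd y; rewrite derive1E => ->; rewrite df0 ?ltW.
- by rewrite in_itv /= lexx x0.
- by rewrite in_itv /= lexx x0.
Qed.

Lemma expR_pade (R : realType) (x : R) : 0 <= x ->
  (6 - 2 * x) * expR x <= x ^+ 2 + 4 * x + 6.
Proof.
pose k0 (y : R) := y ^+ 2 + 4 * y + 6 + (2 * y - 6) * expR y.
pose k1 (y : R) := 2 * y + 4 + (2 * y - 4) * expR y.
pose k2 (y : R) := 2 + (2 * y - 2) * expR y.
have k2_ge0 y : 0 <= y -> 0 <= k2 y.
  move=> y0; rewrite -[leLHS](_ : k2 0 = 0); last by rewrite /k2 expR0; ring.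
  apply: (@derive_ge0_le _ k2 (fun y => 2 * y * expR y)) => // [t|t t0].
    by rewrite /k2; apply: is_derive_eq; rewrite /GRing.scale /=; ring.
  by rewrite !mulr_ge0 ?expR_ge0.
have k1_ge0 y : 0 <= y -> 0 <= k1 y.
  move=> y0; rewrite -[leLHS](_ : k1 0 = 0); last by rewrite /k1 expR0; ring.
  apply: (@derive_ge0_le _ k1 k2) => // t.
  by rewrite /k1 /k2; apply: is_derive_eq; rewrite /GRing.scale /=; ring.
move=> x0; suff : 0 <= k0 x by rewrite /k0; lra.
rewrite -[leLHS](_ : k0 0 = 0); last by rewrite /k0 expR0; ring.
apply: (@derive_ge0_le _ k0 k1) => // t.
by rewrite /k0 /k1; apply: is_derive_eq; rewrite /GRing.scale /=; ring.
Qed.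

Lemma bernstein_exponent (R : realType) (mu M s l : R) :
  0 <= mu <= M -> 0 < M -> 0 <= s -> l * (M + s / 3) = s ->
  mu * (expR l - 1 - l) - l * s <= - (s ^+ 2 / (2 * (M + s / 3))).
Proof.
move=> /andP[mu0 muM] M0 s0; set d := M + s / 3 => ls.
have d0 : 0 < d by rewrite /d; lra.
have l0 : 0 <= l by rewrite -(pmulr_lge0 _ d0) ls.
have e0 : 0 <= expR l - 1 - l by have := expR_ge1Dx l; lra.
have -> : s ^+ 2 / (2 * d) = l * s / 2 by rewrite -ls; field; rewrite gt_eqF.
apply: (@le_trans _ _ (M * (expR l - 1 - l) - l * s)).
  by rewrite lerB// ler_wpM2r.
suff : M * (expR l - 1 - l) <= l * s / 2 by lra.
have -> : M = (6 - 2 * l) * d / 6 by rewrite mulrBl -mulrA ls /d; field.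
have -> : l * s / 2 = d / 6 * (3 * l ^+ 2) by rewrite -ls; field.
rewrite [leLHS](_ : _ = d / 6 * ((6 - 2 * l) * (expR l - 1 - l))); last by field.
apply: ler_wpM2l; first by rewrite divr_ge0// ltW.
have := expR_pade _ _ l0; set x := expR l.
rewrite [in X in _ -> X](_ : (6 - 2 * l) * (x - 1 - l) =
  (6 - 2 * l) * x - (6 + 4 * l - 2 * l ^+ 2)); last by ring.
by lra.
Qed.

Lemma bp_prob_bernstein (R : realType) (r n a t : nat) (p M s : R) :
  0 <= p <= 1 -> (a <= n)%N -> 0 < M -> 0 <= s ->
  (n - a)%:R * pi_hat r p t <= M ->
  t%:R = a%:R + (n - a)%:R * pi_hat r p t + s ->
  1 - expR (- (s ^+ 2 / (2 * (M + s / 3)))) <=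
  bp_prob p a (fun E A0 : {set _} => #|@bp_final n r E A0| < t)%N.
Proof.
move=> p01 an M0 s0; rewrite pi_hatE//; set q := hit_prob p r t 0 => qM tE.
have q0 : 0 <= q by exact: hit_prob_ge0.
have l0 : 0 <= s / (M + s / 3) by rewrite divr_ge0//; lra.
set b := - (_ / _); pose l := s / (M + s / 3).
have lb : (n - a)%:R * q * (expR l - 1 - l) - l * s <= b.
  apply: bernstein_exponent => //; first by rewrite qM mulr_ge0.
  by rewrite /l divfK// gt_eqF//; lra.
apply: le_trans (bp_prob_mgf _ r n a t p (expR l) p01 an _); last first.
  by rewrite -expR0 ler_expR.
rewrite lerB//.
apply: (@le_trans _ _ (expR (a%:R * l) * expR ((n - a)%:R * ((expR l - 1) * q)) /
                       expR (t%:R * l))).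
  rewrite !expRM_natl ler_wpM2r ?invr_ge0 ?exprn_ge0 ?expR_ge0//.
  rewrite ler_wpM2l ?exprn_ge0 ?expR_ge0//.
  have e1 : 0 <= (expR l - 1) * q.
    by rewrite mulr_ge0// subr_ge0 -expR0 ler_expR.
  by apply: lerXn2r; rewrite ?nnegrE ?expR_ge0 ?addr_ge0// expR_ge1Dx.
rewrite -expRD -expRN -expRD ler_expR; apply: le_trans lb.
by rewrite tE le_eqVlt; apply/orP; left; apply/eqP; ring.
Qed.

Lemma bp_tcP (R : realType) (r n : nat) (p : R) :
  bp_drift r n p (bp_tc r n p) = - bp_ac r n p /\
  (bp_tc r n p <= Num.truncn (bp_t0 r n p))%N.
Proof.
set s := bp_times r n p.
have att : has [pred t | bp_drift r n p t == - bp_ac r n p] s.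
  rewrite /bp_ac opprK -/s big_seq.
  apply: (@big_ind _ (fun x => has [pred t | bp_drift r n p t == x] s)).
  - by apply/hasP; exists 0%N => /=.
  - by move=> x y hx hy; rewrite /Num.min; case: ifP.
  - by move=> t ts; apply/hasP; exists t => /=.
have := nth_find 0%N att; rewrite -/(bp_tc r n p).
have lt : (bp_tc r n p < size s)%N by rewrite -has_find.
rewrite size_iota in lt.
by rewrite /= nth_iota// add0n => /eqP.
Qed.

Lemma pi_hat_le (R : realType) (p x : R) (r t : nat) :
  0 <= p <= 1 -> t%:R <= x -> pi_hat r p t <= (x * p) ^+ r / r`!%:R.
Proof.
move=> p01 tx; rewrite pi_hatE//; apply: (le_trans (hit_prob_le _ _ _ _)) => //.
have /andP[p0 _] := p01.
rewrite subn0 ler_pdivlMr ?ltr0n ?fact_gt0// mulr_natr -mulrnA bin_ffact.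
apply: (@le_trans _ _ (p ^+ r * t%:R ^+ r)).
  rewrite -[leLHS]mulr_natr ler_wpM2l ?exprn_ge0// -natrX ler_nat.
  elim: r => [|r IHr]; first by rewrite ffactn0 expn0.
  by rewrite ffactnSr expnSr leq_mul// leq_subr.
rewrite exprMn mulrC ler_wpM2r ?exprn_ge0//.
by apply: lerXn2r => //; rewrite nnegrE// (le_trans _ tx).
Qed.

Lemma bp_delta_ge0 (R : realType) (r n : nat) (p : R) : 0 <= bp_delta r n p.
Proof. by rewrite /bp_delta le_max powR_ge0. Qed.

Lemma bp_t0_pow (R : realType) (r n : nat) (p : R) :
  (2 <= r)%N -> (0 < n)%N -> 0 < p ->
  bp_t0 r n p ^+ r.-1 = (1 + bp_delta r n p) * (r.-1`!%:R / (n%:R * p ^+ r)).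
Proof.
move=> r2 n0 p0; rewrite /bp_t0 -powR_mulrn ?powR_ge0// -powRrM mulVf; last first.
  by rewrite pnatr_eq0; case: r r2 => [|[]].
rewrite powRr1// mulr_ge0 ?addr_ge0 ?bp_delta_ge0//.
by rewrite divr_ge0// mulr_ge0// exprn_ge0// ltW.
Qed.

(* [n (t0 p)^r / r! = (1 + delta) t0 / r] is what [t0] is designed for. *)
Lemma n_pi_hat_tc_le (R : realType) (r n : nat) (p : R) :
  (2 <= r)%N -> (0 < n)%N -> 0 < p <= 1 ->
  n%:R * pi_hat r p (bp_tc r n p) <=
  (1 + bp_delta r n p) * bp_t0 r n p / r%:R.
Proof.
move=> r2 n0 /andP[p0 p1].
have t00 : 0 <= bp_t0 r n p by exact: powR_ge0.
have tc : (bp_tc r n p)%:R <= bp_t0 r n p.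
  rewrite (@le_trans _ _ (Num.truncn (bp_t0 r n p))%:R) ?truncn_le//.
  by rewrite ler_nat; have [] := bp_tcP R r n p.
have := pi_hat_le R p _ r _ _ tc; rewrite (ltW p0) p1 => /(_ isT) le_pi.
apply: (le_trans (ler_wpM2l _ le_pi)) => //.
rewrite le_eqVlt; apply/orP; left; apply/eqP.
case: r r2 t00 tc le_pi => [//|r] r2 t00 tc le_pi.
rewrite exprMn [_ ^+ r.+1]exprSr (bp_t0_pow _ _ _ _ r2 n0 p0) /= factS natrM.
field.
by rewrite nat1r !pnatr_eq0 -!lt0n fact_gt0 n0 expf_neq0 ?gt_eqF.
Qed.

Local Open Scope classical_set_scope.
Local Open Scope ring_scope.

Lemma cvg_powR0 (R : realType) (u : nat -> R) (c : R) : 0 < c ->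
  (\forall n \near \oo, 0 <= u n) -> u n @[n --> \oo] --> (0 : R) ->
  u n `^ c @[n --> \oo] --> (0 : R).
Proof.
move=> c0 u0 /cvgr0Pnorm_le cu; apply/cvgr0Pnorm_le => e e0.
have ec0 : 0 < e `^ c^-1 by rewrite powR_gt0.
near=> n; have un0 : 0 <= u n by near: n.
have une : `|u n| <= e `^ c^-1 by near: n; exact: cu.
rewrite ger0_norm ?powR_ge0//; rewrite ger0_norm// in une.
have -> : e = (e `^ c^-1) `^ c.
  by rewrite -powRrM mulVf ?gt_eqF// powRr1// ltW.
by rewrite ge0_ler_powR ?nnegrE ?powR_ge0// ltW.
Unshelve. all: by end_near. Qed.

Lemma cvg_inv_np (R : realType) (p : nat -> R) :
  little_omega p (fun n => n%:R^-1) ->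
  (n%:R * p n)^-1 @[n --> \oo] --> (0 : R).
Proof.
move=> /cvgryPge hp; apply/cvgr0Pnorm_le => e e0.
near=> n; have : e^-1 <= p n / n%:R^-1 by near: n; exact: hp.
rewrite invrK mulrC => le_np.
have np0 : 0 < n%:R * p n by apply: lt_le_trans le_np; rewrite invr_gt0.
by rewrite gtr0_norm ?invr_gt0// invf_ple.
Unshelve. all: by end_near. Qed.

Lemma near_gt0_of_omega_inv (R : realType) (p : nat -> R) :
  little_omega p (fun n => n%:R^-1) -> \forall n \near \oo, 0 < p n.
Proof.
move=> /cvgryPgt /(_ 0); apply: filterS => n; rewrite invrK => pn.
by rewrite ltNge; apply/negP => p0; move: pn; rewrite ltNge mulr_le0_ge0.
Qed.

Lemma cvg_npr (R : realType) (r : nat) (p : nat -> R) : (0 < r)%N ->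
  p =o_\oo (fun n => n%:R `^ (- r%:R^-1)) ->
  n%:R * p n ^+ r @[n --> \oo] --> (0 : R).
Proof.
move=> r0 /eqoP hp; apply/cvgr0Pnorm_le => e e0.
have d0 : 0 < Num.min 1 e by rewrite lt_min ltr01.
near=> n.
have n0 : (0 : R) < n%:R by rewrite ltr0n; near: n; exact: nbhs_infty_gt.
have : `|p n| <= Num.min 1 e * `|n%:R `^ (- r%:R^-1) : R|.
  by near: n; exact: hp.
rewrite [`|_ `^ _|]ger0_norm ?powR_ge0// => le_p.
rewrite normrM normrX [`|n%:R|]gtr0_norm//.
apply: (@le_trans _ _ (n%:R * (Num.min 1 e * n%:R `^ (- r%:R^-1)) ^+ r)).
  apply: ler_wpM2l; first exact: ltW.
  by apply: lerXn2r => //; rewrite nnegrE// mulr_ge0 ?powR_ge0 ?ltW.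
rewrite exprMn -[X in _ * (_ * X)]powR_mulrn ?powR_ge0// -powRrM mulNr mulVf; last first.
  by rewrite pnatr_eq0 -lt0n.
rewrite powR_inv1 ?(ltW n0)// mulrCA divff ?gt_eqF// mulr1.
apply: (@le_trans _ _ (Num.min 1 e)); last by rewrite ge_min lexx orbT.
by rewrite -[leRHS]expr1 ler_wiXn2l ?(ltW d0)// ge_min lexx.
Unshelve. all: by end_near. Qed.

Lemma cvg_bp_delta (R : realType) (r : nat) (p : nat -> R) :
  (2 <= r)%N -> (forall n, 0 <= p n <= 1) ->
  little_omega p (fun n => n%:R^-1) ->
  p =o_\oo (fun n => n%:R `^ (- r%:R^-1)) ->
  bp_delta r n (p n) @[n --> \oo] --> (0 : R).
Proof.
move=> r2 p01 hp_omega hp_o.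
have p0 n : 0 <= p n by have /andP[] := p01 n.
have r1 : (0 : R) < r.-1%:R by rewrite ltr0n; case: r r2 {hp_o} => [|[]].
have cx : (n%:R * p n ^+ r) `^ (2 * r.-1%:R)^-1 @[n --> \oo] --> (0 : R).
  apply: cvg_powR0; first by rewrite invr_gt0 mulr_gt0.
    by apply: nearW => n; rewrite mulr_ge0// exprn_ge0.
  by apply: cvg_npr => //; exact: ltnW.
have cy : ((n%:R * p n)^-1) `^ (4 * r.-1%:R)^-1 @[n --> \oo] --> (0 : R).
  apply: cvg_powR0; first by rewrite invr_gt0 mulr_gt0.
    by apply: nearW => n; rewrite invr_ge0 mulr_ge0.
  exact: cvg_inv_np.
apply: (@squeeze_cvgr _ _ _ _ (cst 0) (fun n =>
   (n%:R * p n ^+ r) `^ (2 * r.-1%:R)^-1 + ((n%:R * p n)^-1) `^ (4 * r.-1%:R)^-1)).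
- apply: nearW => n; rewrite /cst bp_delta_ge0 /= /bp_delta powRN.
  have np0 : 0 <= n%:R * p n by rewrite mulr_ge0.
  have -> : (n%:R * p n)^-1 `^ (4 * r.-1%:R)^-1 = ((n%:R * p n) `^ (4 * r.-1%:R)^-1)^-1.
    by rewrite -powR_inv1// -powRrM mulN1r powRN.
  by rewrite ge_max lerDl lerDr powR_ge0 invr_ge0 powR_ge0.
- exact: cvg_cst.
- by rewrite -[X in _ --> X](addr0 0); exact: cvgD.
Qed.

Lemma cvg_bp_t0_div (R : realType) (r : nat) (p : nat -> R) :
  (2 <= r)%N -> (forall n, 0 <= p n <= 1) ->
  little_omega p (fun n => n%:R^-1) ->
  p =o_\oo (fun n => n%:R `^ (- r%:R^-1)) ->
  bp_t0 r n (p n) / n%:R @[n --> \oo] --> (0 : R).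
Proof.
move=> r2 p01 hp_omega hp_o.
have r1 : (0 < r.-1)%N by case: r r2 {hp_o} => [|[]].
have p0 n : 0 <= p n by have /andP[] := p01 n.
pose w n := (1 + bp_delta r n (p n)) * r.-1`!%:R * (n%:R * p n)^-1 ^+ r.
have cw : w n @[n --> \oo] --> (0 : R).
  rewrite -[X in _ --> X](_ : (1 + 0) * r.-1`!%:R * 0 ^+ r = 0); last first.
    by rewrite expr0n gtn_eqF ?mulr0// ltnW.
  apply: cvgM.
    apply: cvgM; last exact: cvg_cst.
    by apply: cvgD; [exact: cvg_cst|exact: cvg_bp_delta].
  exact: (cvg_comp _ _ (cvg_inv_np _ _ hp_omega) (@exprn_continuous _ r 0)).
have w0 n : 0 <= w n.
  by rewrite !mulr_ge0 ?addr_ge0 ?bp_delta_ge0 ?exprn_ge0 ?invr_ge0 ?mulr_ge0.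
have cwp : w n `^ (r.-1%:R)^-1 @[n --> \oo] --> (0 : R).
  by apply: cvg_powR0 => //; [rewrite invr_gt0 ltr0n|exact: nearW].
apply: cvg_trans cwp; apply: near_eq_cvg; near=> n.
have n0 : (0 < n)%N by near: n; exact: nbhs_infty_gt.
have pn0 : 0 < p n by near: n; exact: near_gt0_of_omega_inv.
have t00 : 0 <= bp_t0 r n (p n) / n%:R by rewrite divr_ge0// powR_ge0.
rewrite /= -[RHS]powRr1//.
rewrite -[X in _ = _ `^ X](@mulfV _ r.-1%:R) ?pnatr_eq0 -?lt0n// powRrM.
congr (_ `^ _); rewrite powR_mulrn// expr_div_n bp_t0_pow// /w.
have nR0 : (n%:R : R) != 0 by rewrite pnatr_eq0 -lt0n.
have nr : (n%:R : R) ^+ r = n%:R * n%:R ^+ r.-1.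
  by rewrite -exprS prednK// ltnW.
by rewrite exprVn exprMn nr; field; rewrite nR0 !expf_neq0// gt_eqF.
Unshelve. all: by end_near. Qed.

(* With [q = pi_hat t_c], the definition of [a_c] says [a_c (1 - q) = t_c - n q],
   so the mean [a + (n - a) q] falls short of [t_c] by exactly [alpha (1 - q)]. *)
Lemma bp_prob_subcritical (R : realType) (r n a : nat) (p alpha : R) :
  let delta := bp_delta r n p in let t0 := bp_t0 r n p in
  let k := 1 - (1 + delta) * (t0 / n%:R) / r%:R in
  (2 <= r)%N -> (0 < n)%N -> 0 < p <= 1 -> t0 <= n%:R -> 0 < k -> 0 < alpha ->
  a%:R = bp_ac r n p - alpha ->
  1 - expR (- (k ^+ 2 / (1 + delta) *
               (r%:R * alpha ^+ 2 / (2 * (t0 + r%:R * alpha / 3))))) <=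
  bp_prob p a (fun E A0 : {set _} => #|@bp_final n r E A0| < bp_tc r n p)%N.
Proof.
move=> delta t0 k r2 n0 p01 t0n k0 al0 aE.
have /andP[p0 p1] := p01.
have p01' : 0 <= p <= 1 by rewrite (ltW p0).
have nR0 : (0 : R) < n%:R by rewrite ltr0n.
have rR0 : (0 : R) < r%:R by rewrite ltr0n ltnW.
have de0 : 0 <= delta by exact: bp_delta_ge0.
have t00 : 0 < t0.
  rewrite powR_gt0// mulr_gt0 ?divr_gt0 ?ltr0n ?fact_gt0 ?mulr_gt0 ?exprn_gt0//.
  by rewrite ltr_pwDl.
set M := (1 + delta) * t0 / r%:R.
have M0 : 0 < M by rewrite divr_gt0// mulr_gt0// ltr_pwDl.
have [drift_tc tc_t0] := bp_tcP R r n p.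
set tc := bp_tc r n p in drift_tc tc_t0 *.
have tcn : tc%:R <= n%:R :> R.
  apply: le_trans t0n; rewrite (@le_trans _ _ (Num.truncn t0)%:R) ?truncn_le ?(ltW t00)//.
  by rewrite ler_nat.
have nq : n%:R * pi_hat r p tc <= M by exact: n_pi_hat_tc_le.
have q0 : 0 <= pi_hat r p tc by rewrite pi_hatE// hit_prob_ge0.
move: drift_tc nq q0; rewrite /bp_drift; set q := pi_hat r p tc => drift_tc nq q0.
have kq : k <= 1 - q.
  rewrite /k lerB// -(ler_pM2l nR0); apply: le_trans nq _.
  by rewrite /M le_eqVlt; apply/orP; left; apply/eqP; field; rewrite !gt_eqF.
have q1 : 0 < 1 - q by exact: lt_le_trans kq.
set ac := bp_ac r n p in aE drift_tc.
have acE : ac * (1 - q) = tc%:R - n%:R * q.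
  have -> : ac = - ((n%:R * q - tc%:R) / (1 - q)) by rewrite drift_tc opprK.
  by field; rewrite gt_eqF.
have acn : ac <= n%:R.
  by rewrite -(ler_pM2r q1) acE; lra.
have an : (a <= n)%N by rewrite -(ler_nat R); lra.
have s0 : 0 <= alpha * (1 - q) by rewrite mulr_ge0 ?ltW.
apply: le_trans (bp_prob_bernstein _ r _ _ _ _ M _ p01' an M0 s0 _ _); last 2 first.
- by apply: le_trans nq; rewrite ler_wpM2r// ler_nat leq_subr.
- by rewrite -/q natrB// aE; lra.
rewrite lerB// ler_expR lerN2.
set s := alpha * (1 - q); set D := t0 + r%:R * alpha / 3.
have D0 : 0 < D by rewrite addr_gt0// divr_gt0// mulr_gt0.
have Ms : M + s / 3 <= (1 + delta) * D / r%:R.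
  have -> : (1 + delta) * D / r%:R = M + (1 + delta) * alpha / 3.
    by rewrite /D /M; field; rewrite gt_eqF.
  rewrite lerD2l ler_pM2r// /s.
  have : 0 <= alpha * (delta + q) by rewrite mulr_ge0 ?addr_ge0// ltW.
  by lra.
have ks : (k * alpha) ^+ 2 <= s ^+ 2.
  apply: lerXn2r; rewrite ?nnegrE//; first by rewrite mulr_ge0 ?ltW.
  by rewrite /s mulrC ler_pM2l.
have -> : k ^+ 2 / (1 + delta) * (r%:R * alpha ^+ 2 / (2 * D)) =
          (k * alpha) ^+ 2 / (2 * ((1 + delta) * D / r%:R)).
  by field; rewrite !gt_eqF// ltr_pwDl.
have Ms0 : 0 < 2 * (M + s / 3) by rewrite mulr_gt0// ltr_pwDl// divr_ge0.
have Ms2 : 2 * (M + s / 3) <= 2 * ((1 + delta) * D / r%:R) by rewrite ler_pM2l.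
have D2 := lt_le_trans Ms0 Ms2.
apply: ler_pM => //; first exact: sqr_ge0.
  by rewrite invr_ge0 ltW.
by rewrite lef_pV2 ?posrE.
Qed.

Theorem theorem1 (R : realType) (r : nat) (hr : (2 <= r)%N)
    (p : nat -> R) (hp01 : forall n, 0 <= p n <= 1)
    (hp_omega : little_omega p (fun n => n%:R^-1))
    (hp_o : p =o_\oo (fun n => n%:R `^ (- r%:R^-1)))
    (alpha : nat -> R)
    (halpha_omega : little_omega alpha (fun n => Num.sqrt (bp_ac r n (p n))))
    (halpha_le : \forall n \near \oo, alpha n <= bp_ac r n (p n) - r%:R)
    (a : nat -> nat)
    (ha : \forall n \near \oo, (a n)%:R = bp_ac r n (p n) - alpha n) :
  exists2 eps : nat -> R, eps n @[n --> \oo] --> (0 : R) &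
    \forall n \near \oo,
      bp_prob (p n) (a n)
        (fun (E : {set {set 'I_n}}) (A0 : {set 'I_n}) =>
           (#|bp_final r E A0| < bp_tc r n (p n))%N)
      >= 1 - expR (- ((1 + eps n) *
               (r%:R * alpha n ^+ 2 /
                (2 * (bp_t0 r n (p n) + r%:R * alpha n / 3))))).
Proof.
have cd := cvg_bp_delta _ _ _ hr hp01 hp_omega hp_o.
have ct := cvg_bp_t0_div _ _ _ hr hp01 hp_omega hp_o.
pose k n := 1 - (1 + bp_delta r n (p n)) * (bp_t0 r n (p n) / n%:R) / r%:R.
have cd1 : 1 + bp_delta r n (p n) @[n --> \oo] --> (1 : R).
  by rewrite -[X in _ --> X]addr0; apply: cvgD cd; exact: cvg_cst.
have ck : k n @[n --> \oo] --> (1 : R).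
  rewrite -[X in _ --> X](_ : 1 - 1 * 0 / r%:R = 1); last by rewrite mulr0 mul0r subr0.
  apply: cvgB; first exact: cvg_cst.
  by apply: cvgM (cvg_cst _); exact: cvgM.
exists (fun n => k n ^+ 2 / (1 + bp_delta r n (p n)) - 1).
  rewrite -[X in _ --> X](_ : 1 * 1 / 1 - 1 = 0); last by rewrite divr1 mulr1 subrr.
  apply: cvgB; last exact: cvg_cst.
  apply: cvgM; first exact: cvgM.
  by apply: cvgV => //; exact: oner_neq0.
have /cvgryPgt/(_ 0) hal := halpha_omega.
near=> n.
have n0 : (0 < n)%N by near: n; exact: nbhs_infty_gt.
have p0 : 0 < p n by near: n; exact: near_gt0_of_omega_inv.
have al0 : 0 < alpha n.
  have : 0 < alpha n / Num.sqrt (bp_ac r n (p n)).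
    by near: n; exact: hal.
  rewrite !ltNge; apply: contra => al; exact: mulr_le0_ge0.
have t0n : bp_t0 r n (p n) <= n%:R.
  rewrite -[leRHS]mul1r -ler_pdivrMr ?ltr0n//.
  by near: n; exact: cvgr_le ct _ ltr01.
have k0 : 0 < k n by near: n; exact: cvgr_gt ck _ ltr01.
rewrite [1 + (_ - 1)]addrC subrK.
apply: bp_prob_subcritical => //; last by near: n.
by rewrite p0; have /andP[] := hp01 n.
Unshelve. all: by end_near. Qed.
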